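(* Let $D$ be an integral domain that is not a field, and let $F$ be the field of fractions of $D$. For an extension field $K$ of $F$, the following statements hold. (1) If $D$ is a UFD, then $D + xK[x]$ is a GL-domain. (2) If $K$ is a proper extension of $F$, then $D + xK[x]$ is not a pre-Schreier domain.
   Context: Here $D + xK[x]$ denotes the subring of the polynomial ring $K[x]$ consisting of all polynomials whose constant term lies in $D$. Let $R$ be an integral domain. A nonzero polynomial $f \in R[X]$ is called primitive over $R$ if the ideal of $R$ generated by the coefficients of $f$ is not contained in any proper principal ideal of $R$; equivalently, the only common divisors in $R$ of the coefficients of $f$ are the units of $R$. The domain $R$ is a GL-domain if the product of any two primitive polynomials over $R$ is again primitive over $R$. A nonzero nonunit $p \in R$ is primal if whenever $p$ divides $rs$ in $R$ for some $r,s \in R$, one can write $p = r's'$ for some $r',s' \in R$ such that $r'$ divides $r$ and $s'$ divides $s$ in $R$. The domain $R$ is pre-Schreier if every nonzero nonunit of $R$ is primal. *)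

(* Defs.v *)
From HB Require Import structures.
From mathcomp Require Import all_boot all_order all_algebra.
From mathcomp Require Import boolp classical_sets.

Set Implicit Arguments.
Unset Strict Implicit.
Unset Printing Implicit Defensive.

Import GRing.Theory.

Local Open Scope classical_set_scope.
Local Open Scope ring_scope.

Section Domains.
Variable R : idomainType.
Implicit Types (a b p q r s : R) (f g : {poly R}) (u v : seq R).

Definition is_field_domain : Prop := forall a, a != 0 -> a \is a GRing.unit.

Definition divides a b : Prop := exists c, b = a * c.

Definition associates a b : Prop := exists2 c, c \is a GRing.unit & b = a * c.

Definition irreducible p : Prop :=
  [/\ p != 0, p \isn't a GRing.unit &
      forall a b, p = a * b -> a \is a GRing.unit \/ b \is a GRing.unit].

Definition factorization_of a u : Prop :=
  (forall p, p \in u -> irreducible p) /\ a = \prod_(p <- u) p.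

(* [v'] is the reordering of [v] that matches [u] factor by factor. *)
Definition same_factors u v : Prop :=
  exists v', [/\ perm_eq v v', size u = size v' &
                 forall i, (i < size u)%N -> associates u`_i v'`_i].

Definition is_UFD : Prop :=
  forall a, a != 0 -> a \isn't a GRing.unit ->
    (exists u, factorization_of a u) /\
    (forall u v, factorization_of a u -> factorization_of a v ->
                 same_factors u v).

Definition principal_ideal a : set R := [set b | divides a b].

Definition coef_ideal f : set R :=
  [set b | exists c : nat -> R, b = \sum_(i < size f) c i * f`_i].

Definition primitive f : Prop :=
  f != 0 /\
  forall a, principal_ideal a <> setT -> ~ (coef_ideal f `<=` principal_ideal a).

Definition is_GL_domain : Prop :=
  forall f g, primitive f -> primitive g -> primitive (f * g).

Definition primal p : Prop :=
  forall r s, divides p (r * s) ->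
    exists r' s', [/\ p = r' * s', divides r' r & divides s' s].

Definition is_pre_Schreier : Prop :=
  forall p, p != 0 -> p \isn't a GRing.unit -> primal p.

End Domains.

(* An extension field K of F = {fraction D} is a field K with a (necessarily
   injective) ring morphism [iota] from F to K; D lies in K through
   d |-> iota d%:F. *)
Section DplusXK.
Variables (D : idomainType) (K : fieldType).
Variable iota : {rmorphism {fraction D} -> K}.

Definition is_proper_extension : Prop := exists k : K, forall a, iota a != k.

Definition DXK_pred : {pred {poly K}} :=
  fun p => `[< exists d : D, p`_0 = iota (FracField.tofrac d) >].

Lemma DXK_subring_closed : subring_closed DXK_pred.
Proof.
split.
- by apply/asboolP; exists 1; rewrite coef1 !rmorph1.
- move=> p q /asboolP[d pd] /asboolP[e qe]; apply/asboolP; exists (d - e).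
  by rewrite coefB pd qe !rmorphB.
- move=> p q /asboolP[d pd] /asboolP[e qe]; apply/asboolP; exists (d * e).
  by rewrite coef0M pd qe !rmorphM.
Qed.

HB.instance Definition _ :=
  GRing.isSubringClosed.Build {poly K} DXK_pred DXK_subring_closed.

(* The ring D + xK[x]; [val] is its inclusion in K[x]. *)
Record DXK : Type := MkDXK { DXK_val : {poly K}; _ : DXK_val \in DXK_pred }.

HB.instance Definition _ := [isSub for DXK_val].
HB.instance Definition _ := [Choice of DXK by <:].
HB.instance Definition _ := [SubChoice_isSubComNzRing of DXK by <:].

Definition DXK_unit : {pred DXK} := fun p => `[< exists q : DXK, q * p = 1 >].

Definition DXK_inv (p : DXK) : DXK :=
  if pselect (exists q : DXK, q * p = 1) is left h then sval (cid h) else p.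

Lemma DXK_mulVx : {in DXK_unit, left_inverse 1 DXK_inv *%R}.
Proof.
by move=> p /asboolP pu; rewrite /DXK_inv; case: pselect => // h; case: cid.
Qed.

Lemma DXK_unitPl (p q : DXK) : q * p = 1 -> DXK_unit p.
Proof. by move=> qp1; apply/asboolP; exists q. Qed.

Lemma DXK_inv_out : {in [predC DXK_unit], DXK_inv =1 id}.
Proof.
by move=> p /asboolP pNu; rewrite /DXK_inv; case: pselect.
Qed.

HB.instance Definition _ := GRing.ComNzRing_hasMulInverse.Build DXK
  DXK_mulVx DXK_unitPl DXK_inv_out.

Lemma DXK_integral : GRing.integral_domain_axiom DXK.
Proof.
move=> p q /(congr1 val); rewrite rmorphM rmorph0 => /eqP.
by rewrite mulf_eq0 -!(inj_eq val_inj) !rmorph0.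
Qed.

HB.instance Definition _ := GRing.ComUnitRing_isIntegral.Build DXK DXK_integral.

End DplusXK.

(* Main.v *)
(** (1) For a prime ideal P of a domain R, a product of two polynomials has all
   its coefficients in P only if one of the factors does (Gauss).  Let f and g
   be primitive over R = D + xK[x].  A nonzero nonunit of D divides every
   element of xK[x], so f and g, hence f g by Gauss for the ideal xK[x], have a
   coefficient with nonzero constant term.  A common divisor h of the
   coefficients of f g thus has h(0) != 0.  If h is not a unit, it has a prime
   divisor: a prime of D when h is constant, and otherwise an irreducible
   factor of h in K[x], normalized to have constant term 1.  By Gauss this prime
   divides all coefficients of f or of g, a contradiction.

   (2) If k is in K but not in F, then x divides (k x)(k x), but in any
   factorization x = r s in R one factor is a constant c of D, so that the other
   is x / c, which divides k x in R only if k is in F. *)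
Require Import Defs.
From mathcomp Require Import all_boot all_order all_algebra.
From mathcomp Require Import boolp.
From mathcomp Require Import qpoly.

Set Implicit Arguments.
Unset Strict Implicit.
Unset Printing Implicit Defensive.

Import GRing.Theory.

Local Open Scope ring_scope.

(** * Divisibility and primitivity in an integral domain *)

Section Divisibility.
Variable R : idomainType.
Implicit Types (a b p : R) (f g : {poly R}) (u v : seq R).

Lemma divides_refl a : divides a a.
Proof. by exists 1; rewrite mulr1. Qed.

Lemma divides0 a : divides a 0.
Proof. by exists 0; rewrite mulr0. Qed.

Lemma divides_trans a b c : divides a b -> divides b c -> divides a c.
Proof. by move=> [d ->] [e ->]; exists (d * e); rewrite mulrA. Qed.

Lemma dividesD a b c : divides a b -> divides a c -> divides a (b + c).
Proof. by move=> [d ->] [e ->]; exists (d + e); rewrite mulrDr. Qed.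

Lemma divides_mulr a b c : divides a b -> divides a (b * c).
Proof. by move=> [d ->]; exists (d * c); rewrite mulrA. Qed.

Lemma divides_mull a b c : divides a b -> divides a (c * b).
Proof. by rewrite mulrC; apply: divides_mulr. Qed.

(** Zero satisfies this in a domain, so nonvanishing is a separate hypothesis where it matters. *)
Definition prime_element p : Prop :=
  p \isn't a GRing.unit /\
  forall a b, divides p (a * b) -> divides p a \/ divides p b.

Lemma mem_coef_ideal f i : coef_ideal f f`_i.
Proof.
exists (fun j => (j == i)%:R).
have [ltif|leif] := ltnP i (size f).
  rewrite (bigD1 (Ordinal ltif)) //= eqxx mul1r big1 ?addr0 // => j.
  by rewrite -val_eqE /= => /negPf->; rewrite mul0r.
rewrite nth_default // big1 // => j _.
by rewrite ltn_eqF ?mul0r // (leq_trans (ltn_ord j)).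
Qed.

(** The coefficient ideal lies in a principal ideal exactly when the generator divides every
    coefficient, and a principal ideal is the whole ring exactly when its generator is a unit. *)
Lemma primitiveP f :
  primitive f <->
  f != 0 /\ forall a, (forall i, divides a f`_i) -> a \is a GRing.unit.
Proof.
split=> -[f0 prim_f]; split=> // a.
  move=> a_f; apply: contrapT => aNu; apply: (prim_f a) => [aT|b [c ->]].
    have [b ab1] : principal_ideal a 1 by rewrite aT.
    by apply: aNu; apply/unitrPr; exists b.
  apply: (big_ind (divides a)); [exact: divides0|exact: dividesD|move=> i _].
  exact: divides_mull.
move=> aNT sub_f; apply: aNT.
have /unitrP[b [_ ab1]] : a \is a GRing.unit.
  by apply: prim_f => i; apply/sub_f/mem_coef_ideal.
apply/classical_sets.seteqP; split=> // c _.
by exists (b * c); rewrite mulrA ab1 mul1r.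
Qed.

(** * Gauss's lemma for a prime ideal *)

Section Gauss.
Variable P : R -> Prop.
Hypotheses (P0 : P 0) (PD : forall a b, P a -> P b -> P (a + b)).
Hypotheses (PMl : forall a b, P b -> P (a * b)).
Hypothesis P_prime : forall a b, P (a * b) -> P a \/ P b.

(** Take the least [i] and [j] with [f_i] and [g_j] outside [P]. In coefficient [i + j] of the
    product every other term has a factor of smaller index, hence lies in [P]; so would
    [f_i * g_j]. *)
Lemma coefs_prime_ideal f g :
  (forall i, P (f * g)`_i) -> (forall i, P f`_i) \/ (forall i, P g`_i).
Proof.
have min_coef h : ~ (forall i, P h`_i) ->
    exists2 i, ~ P h`_i & forall j, (j < i)%N -> P h`_j.
  move=> /existsNP[i0 Pi0].
  have ex : exists i, `[< ~ P h`_i >] by exists i0; apply/asboolP.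
  case: (ex_minnP ex) => i /asboolP Pi min_i; exists i => // j ltji.
  by apply: contrapT => /asboolP/min_i; rewrite leqNgt ltji.
move=> Pfg; apply: contrapT => /not_orP[].
move=> /min_coef[i Pi lti] /min_coef[j Pj ltj].
have PMr a b : P a -> P (a * b) by rewrite mulrC; apply: PMl.
suff /P_prime[] : P (f`_i * g`_j) by [].
have lti' : (i < (i + j).+1)%N by rewrite ltnS leq_addr.
have := Pfg (i + j)%N; rewrite coefM (bigD1 (Ordinal lti')) //= addKn.
set s := \sum_(_ < _ | _) _ => Ps.
(* Closure under subtraction comes from multiplying by -1. *)
rewrite -[_ * _](addrK s); apply: PD => //; rewrite -mulN1r; apply: PMl.
apply: (big_ind P) => // -[k ltk]; rewrite -val_eqE /= neq_ltn.
move=> /orP[ltki|gtki].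
  exact/PMr/lti.
by apply/PMl/ltj; rewrite ltn_subLR // ltn_add2r.
Qed.

End Gauss.

Lemma irreducible_mulr_unit p c :
  c \is a GRing.unit -> irreducible p -> irreducible (p * c).
Proof.
move=> cu [p0 pNu p_irr]; split.
- by rewrite mulf_neq0 //; apply: contraTneq cu => ->; rewrite unitr0.
- by rewrite unitrMl.
move=> a b pcE; have /p_irr[au|] : p = a * (b / c).
- by rewrite mulrA -pcE mulrK.
- by left.
by rewrite unitrMl ?unitrV //; right.
Qed.

Lemma factorization_mul a b u v :
  factorization_of a u -> factorization_of b v ->
  factorization_of (a * b) (u ++ v).
Proof.
move=> [u_irr ->] [v_irr ->]; split=> [p|]; last by rewrite big_cat.
by rewrite mem_cat => /orP[/u_irr|/v_irr].
Qed.

(** * Irreducible and prime elements of a UFD *)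

Section UFD.
Hypothesis R_ufd : is_UFD R.

(** A unit other than 1 is not a product of irreducibles, so a unit [c] is absorbed into [p], which
    gives [p']; otherwise [p] is prepended to a factorization of [c]. *)
Lemma UFD_multiple_factorization p c :
  irreducible p -> c != 0 ->
  exists w p', [/\ factorization_of (p * c) w, p' \in w & divides p p'].
Proof.
move=> p_irr c0; have [cu|cNu] := boolP (c \is a GRing.unit).
  exists [:: p * c], (p * c); rewrite mem_seq1 eqxx; split=> //.
    split=> [q|]; last by rewrite big_seq1.
    by rewrite mem_seq1 => /eqP->; apply: irreducible_mulr_unit.
  by exists c.
have [[w cw] _] := R_ufd c0 cNu.
exists (p :: w), p; rewrite mem_head; split=> //; last exact: divides_refl.
apply: (@factorization_mul p c [:: p] w) => //; split=> [q|].
  by rewrite mem_seq1 => /eqP->.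
by rewrite big_seq1.
Qed.

(** Write [a * b = p * c]. By uniqueness, the factor of [p * c] that [p] divides is associated to a
    factor of [a] or of [b]. Zeros and units have no usable factorization and are treated first. *)
Lemma UFD_irreducible_prime p : irreducible p -> prime_element p.
Proof.
move=> p_irr; have [p0 pNu _] := p_irr; split=> // a b [c abE].
have [->|a0] := eqVneq a 0; first by left; apply: divides0.
have [->|b0] := eqVneq b 0; first by right; apply: divides0.
have c0 : c != 0.
  by apply: contraTneq (mulf_neq0 a0 b0) => c0; rewrite abE c0 mulr0 eqxx.
have [/unitrP[a' [_ aa']]|aNu] := boolP (a \is a GRing.unit).
  by right; exists (c * a'); rewrite mulrA -abE mulrAC aa' mul1r.
have [/unitrP[b' [_ bb']]|bNu] := boolP (b \is a GRing.unit).
  by left; exists (c * b'); rewrite mulrA -abE -mulrA bb' mulr1.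
have [[u au] _] := R_ufd a0 aNu; have [[v bv] _] := R_ufd b0 bNu.
have [w [p' [pcw p'w p_p']]] := UFD_multiple_factorization p_irr c0.
have ab0 : a * b != 0 by rewrite mulf_neq0.
have abNu : a * b \isn't a GRing.unit by rewrite unitrM negb_and aNu.
have abw : factorization_of (a * b) w by rewrite abE.
have [v' [w_v' size_v' assoc]] :=
  (R_ufd ab0 abNu).2 _ _ (factorization_mul au bv) abw.
have p'v' : p' \in v' by rewrite -(perm_mem w_v').
have lt_p' : (index p' v' < size (u ++ v))%N by rewrite size_v' index_mem.
have [e eu] := assoc _ lt_p'; rewrite nth_index // => p'E.
have : (u ++ v)`_(index p' v') \in u ++ v by apply: mem_nth.
set q := _`__ in p'E *; have pq : divides p q.
  by apply: divides_trans p_p' _; exists e^-1; rewrite p'E mulrK.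
have div_prod s r : q \in s -> r = \prod_(x <- s) x -> divides p r.
  by move=> qs ->; rewrite (big_rem q) //=; apply: divides_mulr.
rewrite mem_cat => /orP[qu|qv]; [left|right].
  exact: div_prod qu au.2.
exact: div_prod qv bv.2.
Qed.

Lemma UFD_prime_divisor a :
  a != 0 -> a \isn't a GRing.unit -> exists2 p, prime_element p & divides p a.
Proof.
move=> a0 aNu; have [[[|p u] [u_irr aE]] _] := R_ufd a0 aNu.
  by move: aNu; rewrite aE big_nil unitr1.
exists p; first by apply/UFD_irreducible_prime/u_irr/mem_head.
by exists (\prod_(q <- u) q); rewrite aE big_cons.
Qed.

End UFD.

End Divisibility.

(** Induction on the size: a divisor that violates irreducibility is nonconstant and strictly
    smaller than [p]. *)
Lemma irreducible_poly_divisor (K : fieldType) (p : {poly K}) :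
  (1 < size p)%N -> exists2 q, irreducible_poly q & q %| p.
Proof.
have [n] := ubnP (size p); elim: n p => // n IHn p size_p p_gt1.
have [p_irr|pNirr] := pselect (irreducible_poly p).
  by exists p.
have [q /not_implyP[q1 /not_implyP[qp /negP q_neqp]]] :
    exists q : {poly K}, ~ (size q != 1%N -> q %| p -> q %= p).
  by apply/existsNP => H; apply: pNirr.
have p0 : p != 0 by rewrite -size_poly_gt0 ltnW.
have q0 : q != 0 by apply: contraNneq p0 => q0; move: qp; rewrite q0 dvd0p.
have ltqp : (size q < size p)%N.
  by rewrite ltn_neqAle dvdp_leq // andbT dvdp_size_eqp.
have [||r r_irr rq] := IHn q; first exact: leq_trans ltqp _.
  by rewrite ltn_neqAle eq_sym q1 size_poly_gt0.
by exists r => //; apply: dvdp_trans qp.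
Qed.

(** * Divisibility and primes in D + xK[x] *)

Section DXKTheory.
Variables (D : idomainType) (K : fieldType).
Variable iota : {rmorphism {fraction D} -> K}.
Notation DXK := (DXK iota).
Implicit Types (a b h : DXK) (c d e : D).

Local Notation "c %:K" := (iota (FracField.tofrac c))
  (at level 2, left associativity, format "c %:K").

Lemma DXK_predP (p : {poly K}) :
  reflect (exists d, p`_0 = d%:K) (p \in DXK_pred iota).
Proof. exact: asboolP. Qed.

Lemma iota_tofrac_eq0 d : (d%:K == 0) = (d == 0).
Proof. by rewrite fmorph_eq0 tofrac_eq0. Qed.

Lemma iota_tofrac_inj d e : d%:K = e%:K -> d = e.
Proof. by move/fmorph_inj/eqP; rewrite tofrac_eq => /eqP. Qed.

Lemma DXK_coef0 a : exists d, (val a)`_0 = d%:K.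
Proof. exact/DXK_predP/(valP a). Qed.

Lemma DXK_coef0M a b : (val (a * b))`_0 = (val a)`_0 * (val b)`_0.
Proof. by rewrite rmorphM coef0M. Qed.

Lemma DXK_coef0_1 : (val (1 : DXK))`_0 = 1.
Proof. by rewrite rmorph1 coef1. Qed.

Lemma DXK_dividesP a b :
  divides a b <-> exists2 t, t \in DXK_pred iota & val b = val a * t.
Proof.
split=> [[t ->]|[t tP bE]]; first by exists (val t); rewrite ?rmorphM ?(valP t).
by exists (MkDXK tP); apply: val_inj; rewrite rmorphM.
Qed.

Fact DXK_const_subproof d : (d%:K)%:P \in DXK_pred iota.
Proof. by apply/DXK_predP; exists d; rewrite coefC. Qed.

Definition DXK_const d : DXK := MkDXK (DXK_const_subproof d).

Lemma DXK_const_unit d :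
  (DXK_const d \is a GRing.unit) = (d \is a GRing.unit).
Proof.
apply/unitrPr/unitrPr => [[b]|[e de1]].
  move/(congr1 (fun a : DXK => (val a)`_0)).
  rewrite DXK_coef0M DXK_coef0_1 coefC.
  have [e ->] := DXK_coef0 b; rewrite -!rmorphM => de1; exists e.
  by apply: iota_tofrac_inj; rewrite de1 !rmorph1.
exists (DXK_const e); apply: val_inj.
by rewrite rmorphM /= -polyCM -!rmorphM de1 !rmorph1.
Qed.

(** Coefficients of positive degree can be divided by [d] in [K], so only the constant term can
    obstruct. *)
Lemma DXK_const_dividesP d a :
  d != 0 ->
  divides (DXK_const d) a <-> exists2 e, divides d e & (val a)`_0 = e%:K.
Proof.
move=> d0; split=> [[b ->]|[_ [e ->] aE]].
  rewrite DXK_coef0M /= coefC /=; have [e ->] := DXK_coef0 b.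
  by exists (d * e); [exists e|rewrite !rmorphM].
have dK0 : d%:K != 0 by rewrite iota_tofrac_eq0.
apply/DXK_dividesP; exists ((d%:K)^-1 *: val a).
  by apply/DXK_predP; exists e; rewrite coefZ aE !rmorphM mulKf.
by rewrite /= mul_polyC scalerA mulfV // scale1r.
Qed.

Lemma DXK_const_prime d :
  d != 0 -> prime_element d -> prime_element (DXK_const d).
Proof.
move=> d0 [dNu d_prime]; split; first by rewrite DXK_const_unit.
move=> a b /DXK_const_dividesP-/(_ d0)[c dc].
have [ca caE] := DXK_coef0 a; have [cb cbE] := DXK_coef0 b.
rewrite DXK_coef0M caE cbE -!rmorphM => /iota_tofrac_inj cE.
rewrite -cE in dc; have [d_a|d_b] := d_prime _ _ dc; [left|right].
  by apply/DXK_const_dividesP => //; exists ca.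
by apply/DXK_const_dividesP => //; exists cb.
Qed.

Fact DXK_coef01_subproof (q : {poly K}) : q`_0 = 1 -> q \in DXK_pred iota.
Proof. by move=> q0; apply/DXK_predP; exists 1; rewrite q0 !rmorph1. Qed.

(** The cofactor in K[x] has the same constant term as [b], so it lies in D + xK[x]. *)
Lemma DXK_coef01_dividesP a b :
  (val a)`_0 = 1 -> divides a b <-> val a %| val b.
Proof.
move=> a0; rewrite DXK_dividesP; split=> [[t _ ->]|/dvdpP[t bE]].
  exact: dvdp_mulIl.
exists t; last by rewrite mulrC.
have [d bd] := DXK_coef0 b; apply/DXK_predP; exists d.
by rewrite -bd bE coef0M a0 mulr1.
Qed.

Lemma DXK_irreducible_prime a :
  (val a)`_0 = 1 -> irreducible_poly (val a) -> prime_element a.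
Proof.
move=> a0 a_irr; split.
  apply/negP => /unitrPr[b /(congr1 val)]; rewrite rmorphM rmorph1 => ab1.
  have := a_irr.1; rewrite ltnNge => /negP; apply.
  have a1 : val a %| 1 by rewrite -ab1 dvdp_mulIl.
  by have := dvdp_leq (oner_neq0 _) a1; rewrite size_poly1.
move=> b c; rewrite !DXK_coef01_dividesP // rmorphM => a_bc.
have [|aNb] := boolP (val a %| val b); [by left|right].
by rewrite -(Gauss_dvdpr _ (q := val b)) // irreducible_poly_coprime.
Qed.

(** The condition on the constant term makes [d] nonzero when [h] is constant, and otherwise allows
    [q] to be scaled to constant term 1, which puts it in D + xK[x]. *)
Lemma DXK_prime_divisor h :
  is_UFD D -> (val h)`_0 != 0 -> h \isn't a GRing.unit ->
  exists2 p, prime_element p & divides p h.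
Proof.
move=> D_ufd h0 hNu; have [size_h|size_h] := leqP (size (val h)) 1.
  have [d hd] := DXK_coef0 h.
  have hE : h = DXK_const d.
    by apply: val_inj; rewrite /= -hd; apply: size1_polyC.
  have d0 : d != 0 by rewrite -iota_tofrac_eq0 -hd.
  have [||p p_prime pd] := UFD_prime_divisor D_ufd (a := d) => //.
    by rewrite -DXK_const_unit -hE.
  have p0 : p != 0.
    by apply: contraNneq d0 => p0; case: pd => c ->; rewrite p0 mul0r.
  exists (DXK_const p); first exact: DXK_const_prime.
  by apply/DXK_const_dividesP => //; exists d.
have [q q_irr qh] := irreducible_poly_divisor size_h.
have q0 : q`_0 != 0.
  case/dvdpP: qh => t hE; apply: contraNneq h0 => q0.
  by rewrite hE coef0M q0 mulr0.
pose q1 := (q`_0)^-1 *: q.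
have q1_q : q1 %= q by rewrite eqp_scale ?invr_eq0.
have q10 : q1`_0 = 1 by rewrite coefZ mulVf.
exists (MkDXK (DXK_coef01_subproof q10)).
  apply: DXK_irreducible_prime => //=; split.
    by rewrite (eqp_size q1_q); apply: q_irr.1.
  move=> r r1; rewrite (eqp_dvdr _ q1_q) => rq.
  by rewrite (eqp_rtrans q1_q); apply: q_irr.2.
by apply/DXK_coef01_dividesP => //=; rewrite (eqp_dvdl _ q1_q).
Qed.

Lemma DXK_primitive_coef0 (f : {poly DXK}) :
  ~ is_field_domain D -> primitive f -> ~ forall i, (val f`_i)`_0 = 0.
Proof.
move=> /existsNP[d /not_implyP[d0 /negP dNu]] /primitiveP[_ f_prim] f0.
move/negP: dNu; apply; rewrite -DXK_const_unit; apply: f_prim => i.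
apply/DXK_const_dividesP => //.
by exists 0; [exact: divides0|rewrite f0 !rmorph0].
Qed.

Lemma DXK_GL_domain :
  ~ is_field_domain D -> is_UFD D -> is_GL_domain DXK.
Proof.
move=> DNF D_ufd f g f_prim g_prim.
have /primitiveP[f0 f_unit] := f_prim; have /primitiveP[g0 g_unit] := g_prim.
apply/primitiveP; split=> [|h h_fg]; first by rewrite mulf_neq0.
apply: contrapT => /negP hNu.
(* First use of Gauss, for the prime ideal xK[x]. *)
have h0 : (val h)`_0 != 0.
  apply/eqP => h0.
  have fg0 i : (val (f * g)`_i)`_0 = 0.
    by have [t ->] := h_fg i; rewrite DXK_coef0M h0 mul0r.
  have [|||||] :=
    @coefs_prime_ideal DXK (fun a => (val a)`_0 = 0) _ _ _ _ f g fg0.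
  - by rewrite rmorph0 coef0.
  - by move=> a b a0 b0; rewrite rmorphD coefD a0 b0 addr0.
  - by move=> a b b0; rewrite DXK_coef0M b0 mulr0.
  - move=> a b; rewrite DXK_coef0M => /eqP.
    by rewrite mulf_eq0 => /orP[]/eqP; [left|right].
  - exact: DXK_primitive_coef0.
  - exact: DXK_primitive_coef0.
have [p [pNu p_prime] ph] := DXK_prime_divisor D_ufd h0 hNu.
have p_fg i : divides p (f * g)`_i by apply: divides_trans (h_fg i).
(* Second use of Gauss, for the ideal generated by [p]. *)
have [] := @coefs_prime_ideal DXK (divides p) (divides0 p) (@dividesD _ p)
  (fun a b => @divides_mull _ p b a) p_prime f g p_fg.
- by move/f_unit; apply/negP.
- by move/g_unit; apply/negP.
Qed.

(** * Factorizations of x and failure of the pre-Schreier property *)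

Fact DXK_scaleX_subproof (k : K) : k *: 'X \in DXK_pred iota.
Proof. by apply/DXK_predP; exists 0; rewrite coefZ coefX mulr0 !rmorph0. Qed.

Definition DXK_scaleX (k : K) : DXK := MkDXK (DXK_scaleX_subproof k).

(** Here [r] is a constant [c] of [D]. If [s * t = k x], multiplying by [c] gives [x * t = c k x],
    so [c k] is the constant term [e] of [t] and [k = e / c]. *)
Lemma DXK_cofactor_divides_scaleX (k : K) r s :
  DXK_scaleX 1 = r * s -> size (val r) = 1%N -> divides s (DXK_scaleX k) ->
  exists z : {fraction D}, iota z = k.
Proof.
move=> /(congr1 val); rewrite rmorphM /= scale1r => rsE size_r.
have [c rc] := DXK_coef0 r.
have rE : val r = (c%:K)%:P by rewrite -rc; apply: size1_polyC; rewrite size_r.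
case/DXK_dividesP => t /DXK_predP[e te] /= kE.
have: 'X * t = (c%:K * k) *: 'X.
  by rewrite {1}rsE -mulrA -kE rE mul_polyC scalerA.
move/(congr1 (fun p : {poly K} => p`_1)).
rewrite mulrC coefMX coefZ coefX /= mulr1 te => ekc.
have c0 : c%:K != 0.
  by apply: contra_eq_neq size_r => c0; rewrite rE c0 size_poly0.
exists (FracField.tofrac e / FracField.tofrac c).
by rewrite fmorph_div /= ekc mulrC mulKf.
Qed.

Lemma DXK_not_pre_Schreier :
  is_proper_extension iota -> ~ is_pre_Schreier DXK.
Proof.
move=> [k kNF] DXK_pS; pose x := DXK_scaleX 1; pose kx := DXK_scaleX k.
have kNF' : ~ exists z : {fraction D}, iota z = k by case=> z /eqP; apply/negP.
have x0 : x != 0.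
  by rewrite -(inj_eq val_inj) rmorph0 /= scale1r polyX_eq0.
have xNu : x \isn't a GRing.unit.
  apply/negP => /unitrPr[b /(congr1 (fun a : DXK => (val a)`_0))] /eqP.
  by rewrite DXK_coef0M DXK_coef0_1 /= scale1r coefX mul0r eq_sym oner_eq0.
have x_kxkx : divides x (kx * kx).
  (* The cofactor has constant term 0, so it is in the ring for any [k]. *)
  apply/DXK_dividesP; exists ((k * k) *: 'X); first exact: DXK_scaleX_subproof.
  by rewrite rmorphM /= scale1r -scalerAl -!scalerAr scalerA.
have [r [s [xE r_kx s_kx]]] := DXK_pS x x0 xNu kx kx x_kxkx.
have size_rs : size (val r * val s) = 2%N.
  by rewrite -rmorphM -xE /= scale1r size_polyX.
have r0 : val r != 0.
  by apply: contra_eq_neq size_rs => ->; rewrite mul0r size_poly0.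
have s0 : val s != 0.
  by apply: contra_eq_neq size_rs => ->; rewrite mulr0 size_poly0.
(* The two sizes are positive and add up to 3. *)
have /orP[/eqP r1|/eqP s1] : (size (val r) == 1%N) || (size (val s) == 1%N).
  move: size_rs; rewrite size_mul //; move: r0 s0; rewrite -!size_poly_gt0.
  by case: (size (val r)) (size (val s)) => [|[|n]] [|[|m]] //=; rewrite !addnS.
- exact: kNF' (DXK_cofactor_divides_scaleX xE r1 s_kx).
- by rewrite mulrC in xE; apply: kNF' (DXK_cofactor_divides_scaleX xE s1 r_kx).
Qed.

End DXKTheory.

Theorem proposition3p6 (D : idomainType) (D_not_field : ~ is_field_domain D)
    (K : fieldType) (iota : {rmorphism {fraction D} -> K}) :
  (is_UFD D -> is_GL_domain (DXK iota)) /\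
  (is_proper_extension iota -> ~ is_pre_Schreier (DXK iota)).
Proof.
split; [exact: DXK_GL_domain|exact: DXK_not_pre_Schreier].
Qed.
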